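(* Consider the vector-valued optimal control problem $(P)$: minimize, in the Pareto sense, the vector functional with components $I_i[x(\cdot),u(\cdot)]=\int_a^b L_i(t,x(t),u(t))\,dt$, $i=1,\dots,N$, subject to $\dot x(t)=\varphi(t,x(t),u(t))$, $u(t)\in\Omega$, $x(a)=\alpha$, $x(b)=\beta$. Put $L=(L_1,\dots,L_N)$ and $$\mathcal{H}(t,x,u,\psi,\lambda)=\lambda\cdot L(t,x,u)+\psi\cdot\varphi(t,x,u).$$ Suppose there exist $\varepsilon>0$ and a $C^2$-smooth one-parameter group of transformations $$h^s:[a,b]\times\mathbb{R}^n\times\mathbb{R}^r\to\mathbb{R}\times\mathbb{R}^n\times\mathbb{R}^r,\qquad h^s(t,x,u)=\bigl(T(t,x,u,s),X(t,x,u,s),U(t,x,u,s)\bigr),\quad s\in(-\varepsilon,\varepsilon),$$ with $h^0(t,x,u)=(t,x,u)$ for all $(t,x,u)\in[a,b]\times\mathbb{R}^n\times\mathbb{R}^r$, such that, for all $s\in(-\varepsilon,\varepsilon)$ and for every pair $(x(\cdot),u(\cdot))$ consisting of a piecewise-continuous control $u(\cdot)$ with values in $\Omega$ and a corresponding trajectory $x(\cdot)$ of $\dot x=\varphi(t,x,u)$, the following identities in $t$ hold on $[a,b]$: $$\frac{d}{dt}X(t,x(t),u(t),s)=\varphi\circ h^s(t,x(t),u(t))\,\frac{d}{dt}T(t,x(t),u(t),s),$$ $$L(t,x(t),u(t))=L\circ h^s(t,x(t),u(t))\,\frac{d}{dt}T(t,x(t),u(t),s).$$ Then $$\psi(t)\cdot\frac{\partial}{\partial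 s}X(t,x(t),u(t),s)\Big|_{s=0}-\mathcal{H}(t,x(t),u(t),\psi(t),\lambda)\,\frac{\partial}{\partial s}T(t,x(t),u(t),s)\Big|_{s=0}=\text{const}$$ is an unimprovable (Pareto) conservation law for problem $(P)$; that is, for every Pareto extremal $(x(\cdot),u(\cdot),\psi(\cdot),\lambda)$ of $(P)$ the left-hand side is constant in $t\in[a,b]$.
   Context: Setting. $a<b$ are fixed real numbers, $\alpha,\beta\in\mathbb{R}^n$ are given, and $\Omega\subseteq\mathbb{R}^r$ is a given set. The functions $L=(L_1,\dots,L_N):\mathbb{R}\times\mathbb{R}^n\times\mathbb{R}^r\to\mathbb{R}^N$ and $\varphi:\mathbb{R}\times\mathbb{R}^n\times\mathbb{R}^r\to\mathbb{R}^n$ are continuously differentiable with respect to all variables. Controls $u(\cdot)=(u_1(\cdot),\dots,u_r(\cdot))$ are piecewise-continuous functions on $[a,b]$ with values in $\Omega$, and $x(\cdot)=(x_1(\cdot),\dots,x_n(\cdot))$ is the corresponding state trajectory. The symbol $\frac{d}{dt}$ denotes the total derivative in $t$ along $(x(t),u(t))$, and $\frac{\partial}{\partial s}$ the partial derivative with respect to the parameter $s$. Pareto solution of $(P)$. An admissible pair $(\tilde x(\cdot),\tilde u(\cdot))$ such that for every admissible pair $(x(\cdot),u(\cdot))$ either $I_i[\tilde x(\cdot),\tilde u(\cdot)]=I_i[x(\cdot),u(\cdot)]$ for all $i\in\{1,\dots,N\}$, or $I_i[\tilde x(\cdot),\tilde u(\cdot)]<I_i[x(\cdot),u(\cdot)]$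 for at least one $i$. (This notion defines the problem; the conclusion concerns the extremals defined next.) Pareto extremal of $(P)$. A quadruple $(x(\cdot),u(\cdot),\psi(\cdot),\lambda)$ satisfying the first-order necessary conditions for Pareto optimality (the ''general theorem of optimal control''): $(x(\cdot),u(\cdot))$ is an admissible pair (it satisfies the control system, the control constraint and the boundary conditions); $\psi(\cdot)$ is a continuous $n$-vector function on $[a,b]$ with piecewise-continuous derivative; $\lambda=(\lambda_1,\dots,\lambda_N)$ is a constant vector with $\lambda_j\le 0$ for $j=1,\dots,N$; $(\psi(\cdot),\lambda)\ne 0$; and the following hold: (1) $\dot x(t)=\frac{\partial\mathcal{H}}{\partial\psi}(t,x(t),u(t),\psi(t),\lambda)$ and $\dot\psi(t)=-\frac{\partial\mathcal{H}}{\partial x}(t,x(t),u(t),\psi(t),\lambda)$; (2) $\mathcal{H}(t,x(t),u(t),\psi(t),\lambda)=\max_{v\in\Omega}\mathcal{H}(t,x(t),v,\psi(t),\lambda)$; (3) $t\mapsto\mathcal{H}(t,x(t),u(t),\psi(t),\lambda)$ is continuous and, on each interval of continuity of $u(\cdot)$, is differentiable with $\frac{d\mathcal{H}}{dt}=\frac{\partial\mathcal{H}}{\partial t}$ (both evaluated along the quadruple). Unimprovable (Pareto) conservation law for $(P)$. An equation $C(t,x(t),u(t),\psi(t),\lambda)=\text{constant}$ valid in $t\in[a,b]$ for every Pareto extremal of $(P)$, i.e. for every quadruple $(x(\cdot),u(\cdot),\psi(\cdot),\lambda)$ such that $(x(\cdot),u(\cdot))$ is an admissible pair, $\psi(\cdot)$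 is continuous with piecewise-continuous derivative, $\lambda$ is a constant vector with $\lambda_j\le 0$ for $j=1,\dots,N$, $(\psi(\cdot),\lambda)\ne 0$, the pseudo-Hamiltonian system $\dot x=\frac{\partial\mathcal{H}}{\partial\psi}$, $\dot\psi=-\frac{\partial\mathcal{H}}{\partial x}$ holds along the quadruple, $\mathcal{H}(t,x(t),u(t),\psi(t),\lambda)=\max_{v\in\Omega}\mathcal{H}(t,x(t),v,\psi(t),\lambda)$, and $t\mapsto\mathcal{H}(t,x(t),u(t),\psi(t),\lambda)$ is continuous and, on each interval of continuity of $u(\cdot)$, differentiable with $\frac{d\mathcal{H}}{dt}=\frac{\partial\mathcal{H}}{\partial t}$.
   Formalization: Added hypothesis: along every pair (x,u) and at each t, U(t,x(t),u(t),s) lies in Ω for all small s (automatic for open Ω). Without it the claim fails: Ω={0}, φ=u, L=1, α=β=0, h^s=(t,x+st,u+s), with x=u=0, ψ=1, λ=−1, gives t. *)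

(* Defs.v *)
From HB Require Import structures.
From mathcomp Require Import all_boot all_order all_algebra.
From mathcomp Require Import all_classical all_reals all_analysis.

Set Implicit Arguments.
Unset Strict Implicit.
Unset Printing Implicit Defensive.

Import Order.TTheory GRing.Theory Num.Theory.
Import numFieldNormedType.Exports.

Local Open Scope classical_set_scope.
Local Open Scope ring_scope.

(* [C_on k O f]: f is C^k on the open set O. In finite dimension, asking for
   differentiability and for every directional derivative to be C^(k-1) is the
   usual notion. *)
Fixpoint C_on (R : realType) (V W : normedModType R) (k : nat) (O : set V)
    (f : V -> W) : Prop :=
  if k is k'.+1 then
    (forall p, O p -> differentiable f p) /\
    (forall v, C_on k' O (fun p => 'D_v f p))
  else forall p, O p -> {for p, continuous f}.

(* C^k on a set that need not be open: restriction of a C^k function defined on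
   an open neighbourhood of that set. *)
Definition C_smooth_on (R : realType) (V W : normedModType R) (k : nat)
    (A : set V) (f : V -> W) : Prop :=
  exists (O : set V) (g : V -> W),
    [/\ open O, A `<=` O, C_on k O g & forall p, A p -> f p = g p].

Definition dotv (R : realType) (n : nat) (v w : 'rV[R]_n) : R :=
  \sum_(i < n) v 0 i * w 0 i.

Definition grad (R : realType) (n : nat) (f : 'rV[R]_n -> R) (p : 'rV[R]_n) :
    'rV[R]_n :=
  \row_(j < n) 'D_(delta_mx 0 j) f p.

(* Finitely many discontinuities, with finite one-sided limits everywhere. The
   value at a jump is arbitrary. *)
Definition piecewise_continuous (R : realType) (V : normedModType R) (a b : R)
    (f : R -> V) : Prop :=
  [/\ exists D : seq R,
        forall t, a < t < b -> t \notin D -> {for t, continuous f},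
      forall t, a <= t < b -> cvg (f @ t^'+)
    & forall t, a < t <= b -> cvg (f @ t^'-)].

(* The sense in which every equation df/dt = g on [a, b] is understood when a
   piecewise continuous control u is involved (state equation, adjoint
   equation, evolution of the Hamiltonian, invariance identities): f is
   continuous on the whole of [a, b], jump points of u included, and has
   derivative g(t) at the interior points t where u is continuous. *)
Definition evolves (R : realType) (V W : normedModType R) (a b : R)
    (u : R -> V) (f g : R -> W) : Prop :=
  {within `[a, b], continuous f} /\
  (forall t, a < t < b -> {for t, continuous u} -> is_derive t 1 f (g t)).

(* Points (t, x, u). *)
Notation txu R n r := (R * 'rV[R]_n * 'rV[R]_r)%type.

Record control_problem (R : realType) (n r N : nat) := ControlProblem {
  t_init : R;
  t_final : R;
  x_init : 'rV[R]_n;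
  x_final : 'rV[R]_n;
  ctrl_set : set 'rV[R]_r;
  lagr : txu R n r -> 'rV[R]_N;
  dyn : txu R n r -> 'rV[R]_n }.

Section Problem.
Context (R : realType) (n r N : nat) (P : control_problem R n r N).

Local Notation a := (t_init P).
Local Notation b := (t_final P).
Local Notation Omega := (ctrl_set P).
Local Notation L := (lagr P).
Local Notation phi := (dyn P).

Definition process (x : R -> 'rV[R]_n) (u : R -> 'rV[R]_r) : Prop :=
  [/\ piecewise_continuous a b u,
      forall t, a <= t <= b -> Omega (u t)
    & evolves a b u x (fun t => phi (t, x t, u t))].

Definition admissible (x : R -> 'rV[R]_n) (u : R -> 'rV[R]_r) : Prop :=
  [/\ process x u, x a = x_init P & x b = x_final P].

Definition hamiltonian (t : R) (x : 'rV[R]_n) (u : 'rV[R]_r)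
    (psi : 'rV[R]_n) (lam : 'rV[R]_N) : R :=
  dotv lam (L (t, x, u)) + dotv psi (phi (t, x, u)).

Local Notation H := hamiltonian.

Record Pareto_extremal (x : R -> 'rV[R]_n) (u : R -> 'rV[R]_r)
    (psi : R -> 'rV[R]_n) (lam : 'rV[R]_N) : Prop := {
  extremal_admissible : admissible x u;
  extremal_adjoint_piecewise_C1 :
    exists dpsi : R -> 'rV[R]_n,
      piecewise_continuous a b dpsi /\ evolves a b u psi dpsi;
  extremal_multipliers : forall j, lam 0 j <= 0;
  extremal_nontrivial : (exists2 t, a <= t <= b & psi t != 0) \/ lam != 0;
  extremal_state : evolves a b u x
    (fun t => grad (fun q => H t (x t) (u t) q lam) (psi t));
  extremal_adjoint : evolves a b u psi
    (fun t => - grad (fun y => H t y (u t) (psi t) lam) (x t));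
  extremal_maximality : forall t v, a <= t <= b -> Omega v ->
    H t (x t) v (psi t) lam <= H t (x t) (u t) (psi t) lam;
  extremal_hamiltonian : evolves a b u
    (fun t => H t (x t) (u t) (psi t) lam)
    (fun t => derive1 (fun tau => H tau (x t) (u t) (psi t) lam) t) }.

Definition unimprovable_conservation_law
    (C : R -> 'rV[R]_n -> 'rV[R]_r -> 'rV[R]_n -> 'rV[R]_N -> R) : Prop :=
  forall x u psi lam, Pareto_extremal x u psi lam ->
    exists c : R, forall t, a <= t <= b -> C t (x t) (u t) (psi t) lam = c.

(* A transformation (t, x, u) |-> h^s(t, x, u) is only meaningful for t in
   [a, b] and |s| < eps. Since T may leave [a, b], the group law is required
   exactly where both of its sides are defined. *)
Definition C2_one_parameter_group (eps : R)
    (h : R -> txu R n r -> txu R n r) : Prop :=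
  [/\ C_smooth_on 2
        [set q : txu R n r * R | a <= q.1.1.1 <= b /\ `|q.2| < eps]
        (fun q => h q.2 q.1),
      forall p, a <= p.1.1 <= b -> h 0 p = p
    & forall s s' p, `|s| < eps -> `|s'| < eps -> `|s + s'| < eps ->
        a <= p.1.1 <= b -> a <= (h s' p).1.1 <= b ->
        h s (h s' p) = h (s + s') p].

Definition invariant_under (eps : R) (h : R -> txu R n r -> txu R n r) : Prop :=
  forall x u s, process x u -> `|s| < eps ->
    let hs t := h s (t, x t, u t) in
    let T t := (hs t).1.1 in
    let X t := (hs t).1.2 in
    [/\ evolves a b u T (derive1 T),
        evolves a b u X (fun t => derive1 T t *: phi (hs t))
      & forall t, a < t < b -> {for t, continuous u} ->
          L (t, x t, u t) = derive1 T t *: L (hs t)].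

(* U(t, x(t), u(t), s) lies in Omega for small s (how small may depend on t).
   Automatic when Omega is open, or when h^s preserves Omega. Without it the
   maximality condition says nothing about U, and the Noether quantity need not
   be constant: take n = r = N = 1, Omega = {0}, phi = u, L = 1,
   x(a) = x(b) = 0, h^s(t, x, u) = (t, x + s t, u + s); then x = 0, u = 0,
   psi = 1, lambda = -1 is an extremal and psi dX/ds - H dT/ds = t. *)
Definition respects_controls (h : R -> txu R n r -> txu R n r) : Prop :=
  forall x u t, process x u -> a <= t <= b ->
    \forall s \near 0, Omega (h s (t, x t, u t)).2.

Definition noether_quantity (h : R -> txu R n r -> txu R n r)
    (t : R) (x : 'rV[R]_n) (u : 'rV[R]_r) (psi : 'rV[R]_n) (lam : 'rV[R]_N) : R :=
  dotv psi (derive1 (fun s => (h s (t, x, u)).1.2) 0)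
  - H t x u psi lam * derive1 (fun s => (h s (t, x, u)).1.1) 0.

End Problem.

(* Main.v *)
(** Write [T s t], [X s t] for the first two components of [h s] along an
    extremal. Changing the control at a single time does not change the state
    equation, and [T s], [X s] must remain continuous; hence [T] and [X] do not
    depend on the value taken by the control in [Omega], the control may be
    frozen at [u t0], and near a continuity point [t0] of [u] the functions
    [T s], [X s] are smooth in [(t, s)]. Differentiating
    [psi . X' + lam . L = T' H(h s (t, x, u))] in [s] at [0], exchanging the
    mixed derivatives, and using the adjoint equation, [dH/dt = H_t] and the
    stationarity of [H] in the direction of the control (a consequence of
    maximality), the derivative of [psi . X_s - H T_s] vanishes at [t0]. This
    quantity is moreover continuous on the whole of [[a, b]], jumps of [u]
    included, so it is constant. *)
Require Import Defs.
From HB Require Import structures.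
From mathcomp Require Import all_boot all_order all_algebra.
From mathcomp Require Import all_classical all_reals all_analysis.
From mathcomp Require Import ring.

Set Implicit Arguments.
Unset Strict Implicit.
Unset Printing Implicit Defensive.

Import Order.TTheory GRing.Theory Num.Theory.
Import numFieldNormedType.Exports.

Local Open Scope classical_set_scope.
Local Open Scope ring_scope.

(** * Directional derivatives and symmetry of second derivatives *)

Section Calculus.
Context {R : realType}.
Implicit Types U V W : normedModType R.

(** The difference quotient commutes with [l]. This serves for projections, matrix entries and
    [dotv v]. *)
Lemma is_derive_linear V W W' (l : {linear W -> W'}) (f : V -> W) x v df :
  continuous l -> is_derive x v f df -> is_derive x v (l \o f) (l df).
Proof.
move=> cl [dfx <-].
suff lim_l : h^-1 *: (l (f (h *: v + x)) - l (f x)) @[h --> 0^'] --> l ('D_v f x).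
  by apply: DeriveDef; [apply/cvg_ex; exists (l ('D_v f x))|apply/cvg_lim].
rewrite (_ : (fun h => _) = l \o (fun h => h^-1 *: (f (h *: v + x) - f x))).
  exact: cvg_comp dfx (cl _).
by apply/funext => h /=; rewrite linearZZ (linearB l).
Qed.

Lemma is_derive_fst V W W' (f : V -> (W * W')%type) x v df :
  is_derive x v f df -> is_derive x v (fun y => (f y).1) df.1.
Proof.
apply: (is_derive_linear (l := (fst : {linear (W * W')%type -> W}))).
by move=> p; exact: cvg_fst.
Qed.

Lemma is_derive_snd V W W' (f : V -> (W * W')%type) x v df :
  is_derive x v f df -> is_derive x v (fun y => (f y).2) df.2.
Proof.
apply: (is_derive_linear (l := (snd : {linear (W * W')%type -> W'}))).
by move=> p; exact: cvg_snd.
Qed.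

(** Named so that taking an entry can carry the structure of a linear map and be fed to
    [is_derive_linear]. *)
Definition mx_coord m n (i : 'I_m) (j : 'I_n) (M : 'M[R]_(m, n)) := M i j.

Fact mx_coord_is_linear m n i j : linear (@mx_coord m n i j).
Proof. by move=> k M M'; rewrite /mx_coord !mxE. Qed.

HB.instance Definition _ m n i j := GRing.isLinear.Build _ _ _ _
  (@mx_coord m n i j) (mx_coord_is_linear i j).

Lemma is_derive_coord V m n (f : V -> 'M[R]_(m, n)) x v df i j :
  is_derive x v f df -> is_derive x v (fun y => f y i j) (df i j).
Proof.
apply: (is_derive_linear (l := mx_coord i j)); exact: coord_continuous.
Qed.

Lemma is_derive_pair V W W' (f : V -> W) (g : V -> W') x v df dg :
  is_derive x v f df -> is_derive x v g dg ->
  is_derive x v (fun y => (f y, g y)) (df, dg).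
Proof.
move=> [dfx <-] [dgx <-].
suff lim_fg : h^-1 *: ((f (h *: v + x), g (h *: v + x)) - (f x, g x))
    @[h --> 0^'] --> ('D_v f x, 'D_v g x).
  by apply: DeriveDef; [apply/cvg_ex; exists ('D_v f x, 'D_v g x)|apply/cvg_lim].
exact: cvg_pair dfx dgx.
Qed.

Lemma is_derive_curve V W (g : V -> W) (c : R -> V) (t : R) dc :
  is_derive t 1 c dc -> differentiable g (c t) ->
  is_derive t 1 (g \o c) ('d g (c t) dc).
Proof.
move=> [/derivable1_diffP ct <-] gct.
have gc : differentiable (g \o c) t by exact: differentiable_comp.
by apply: DeriveDef; [exact/derivable1_diffP|rewrite (deriveE _ gc) diff_comp//= (deriveE _ ct)].
Qed.

(** Reduces a directional derivative to a derivative in one real variable, to which the mean value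
    theorem applies. *)
Lemma is_derive_along V W (f : V -> W) p v (t : R) df :
  is_derive (p + t *: v) v f df -> is_derive t 1 (fun z => f (p + z *: v)) df.
Proof.
move=> [dfx <-].
suff E : (fun h : R => h^-1 *: (f (p + (h *: 1 + t) *: v) - f (p + t *: v))) =
    (fun h => h^-1 *: (f (h *: v + (p + t *: v)) - f (p + t *: v))).
  by apply: DeriveDef; [rewrite /derivable/= E|rewrite /derive/= E].
apply/funext => h; congr (_ *: (f _ - _)).
by rewrite scalerDl addrCA [h *: 1]mulr1.
Qed.

(* Both mixed derivatives are, up to a factor [k ^+ 2], values near [p] of the
   second difference of [f] over the parallelogram with sides [k *: v] and [k *: w]. *)
Lemma mixed_derivatives_eq V (f fv fw fvw fwv : V -> R) (p v w : V) :
  (\forall q \near p, [/\ is_derive q v f (fv q), is_derive q w f (fw q),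
     is_derive q w fv (fvw q) & is_derive q v fw (fwv q)]) ->
  {for p, continuous fvw} -> {for p, continuous fwv} -> fvw p = fwv p.
Proof.
have second_difference (g gv gvw : V -> R) (v' w' : V) (k : R) : 0 < k ->
    (forall s t, 0 <= s <= k -> 0 <= t <= k ->
      is_derive (p + s *: v' + t *: w') v' g (gv (p + s *: v' + t *: w')) /\
      is_derive (p + s *: v' + t *: w') w' gv (gvw (p + s *: v' + t *: w'))) ->
    exists s t, [/\ 0 <= s <= k, 0 <= t <= k &
      g (p + k *: v' + k *: w') - g (p + k *: v') - g (p + k *: w') + g p
      = gvw (p + s *: v' + t *: w') * k ^+ 2].
  move=> k0 dg; have kk : 0 <= k <= k by rewrite (ltW k0) lexx.
  have k00 : 0 <= (0 : R) <= k by rewrite lexx (ltW k0).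
  have dgv s t : 0 <= s <= k -> 0 <= t <= k ->
      is_derive s 1 (fun z => g (p + z *: v' + t *: w')) (gv (p + s *: v' + t *: w')).
    move=> hs ht; under eq_fun => z do rewrite addrAC.
    by apply: is_derive_along; rewrite addrAC; case: (dg s t hs ht).
  (* The second difference is [G k - G 0]. The mean value theorem is applied to [G], hence along
     [v'], and then to [gv] along [w']. *)
  pose G s := g (p + s *: v' + k *: w') - g (p + s *: v' + 0 *: w').
  have dG s : 0 <= s <= k ->
      is_derive s 1 G (gv (p + s *: v' + k *: w') - gv (p + s *: v' + 0 *: w')).
    by move=> hs; apply: is_deriveB; exact: dgv.
  have [s] : exists2 s, s \in `[0, k] & G k - G 0 =
      (gv (p + s *: v' + k *: w') - gv (p + s *: v' + 0 *: w')) * (k - 0).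
    apply: MVT_segment (ltW k0) _ _ => [s|].
      by rewrite in_itv/= => /andP[/ltW s0 /ltW sk]; apply: dG; rewrite s0.
    by apply: derivable_within_continuous => s; rewrite in_itv/= => /dG[].
  rewrite in_itv/= => hs EG.
  have dgvw t : 0 <= t <= k -> is_derive t 1 (fun z => gv (p + s *: v' + z *: w'))
      (gvw (p + s *: v' + t *: w')).
    by move=> ht; apply: is_derive_along; case: (dg s t hs ht).
  have [t] : exists2 t, t \in `[0, k] &
      gv (p + s *: v' + k *: w') - gv (p + s *: v' + 0 *: w') =
      gvw (p + s *: v' + t *: w') * (k - 0).
    apply: (@MVT_segment _ (fun z => gv (p + s *: v' + z *: w'))) (ltW k0) _ _ => [t|].
      by rewrite in_itv/= => /andP[/ltW t0 /ltW tk]; apply: dgvw; rewrite t0.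
    by apply: derivable_within_continuous => t; rewrite in_itv/= => /dgvw[].
  rewrite in_itv/= => ht Egv; exists s, t; split => //.
  move: EG; rewrite Egv /G !scale0r !addr0 subr0 expr2 mulrA => <-.
  by rewrite opprB addrA; ring.
move=> df cvw cwv; apply/eqP; rewrite -subr_eq0 -normr_le0.
apply/ler_addgt0Pr => e e0; rewrite add0r.
move/cvgrPdist_lt : cvw => /(_ _ (divr_gt0 e0 (@ltr0n R 2)))cvw.
move/cvgrPdist_lt : cwv => /(_ _ (divr_gt0 e0 (@ltr0n R 2)))cwv.
have /nbhs_ballP[d /= d0 near_p] : nbhs p [set q |
    [/\ is_derive q v f (fv q), is_derive q w f (fw q),
        is_derive q w fv (fvw q) & is_derive q v fw (fwv q)] /\
    (`|fvw p - fvw q| < e / 2 /\ `|fwv p - fwv q| < e / 2)].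
  exact: filterI df (filterI cvw cwv).
(* Since [k * m = d / 2], the whole parallelogram lies in the ball of radius [d]; the summand [1]
   keeps [m] positive when [v] and [w] vanish. *)
pose m := `|v| + `|w| + 1.
have m0 : 0 < m by rewrite ltr_wpDl// addr_ge0.
pose k := d / (2 * m).
have k0 : 0 < k by rewrite divr_gt0// mulr_gt0.
have in_ball s t : 0 <= s <= k -> 0 <= t <= k -> ball p d (p + s *: v + t *: w).
  move=> /andP[s0 sk] /andP[t0 tk].
  rewrite -ball_normE/= -addrA opprD addrA subrr add0r normrN.
  rewrite (le_lt_trans (ler_normD _ _))// !normrZ !ger0_norm//.
  apply: (@le_lt_trans _ _ (k * m)).
    rewrite /m !mulrDr mulr1 -[leLHS]addr0 !lerD ?(ltW k0)//.
    - by rewrite ler_wpM2r.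
    - by rewrite ler_wpM2r.
  rewrite /k invfM mulrA -mulrA mulVf ?gt_eqF// mulr1.
  by rewrite ltr_pdivrMr// ltr_pMr// ltr1n.
have [s [t [hs ht E]]] := second_difference f fv fvw v w k k0
  (fun s t hs ht => let: conj (And4 a _ b _) _ := near_p _ (in_ball s t hs ht) in conj a b).
have [t' [s' [ht' hs' E']]] : exists t s, [/\ 0 <= t <= k, 0 <= s <= k &
    f (p + k *: w + k *: v) - f (p + k *: w) - f (p + k *: v) + f p
      = fwv (p + t *: w + s *: v) * k ^+ 2].
  apply: (second_difference f fw) => // t' s' ht' hs'; rewrite addrAC.
  by have [[]] := near_p _ (in_ball s' t' hs' ht').
(* The second difference is symmetric in [v] and [w], so the two intermediate values agree; each is
   within [e / 2] of the value at [p]. *)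
have {E E'} : fvw (p + s *: v + t *: w) = fwv (p + s' *: v + t' *: w).
  apply: (@mulIf _ (k ^+ 2)); first by rewrite expf_neq0// gt_eqF.
  by rewrite -E (addrAC p (s' *: v)) -E' (addrAC p (k *: w)); ring.
have [_ [/= + _]] := near_p _ (in_ball _ _ hs ht).
have [_ [_ /= +]] := near_p _ (in_ball _ _ hs' ht').
move=> wv vw E; rewrite (splitr e).
rewrite -(subrKA (fvw (p + s *: v + t *: w))) (le_trans (ler_normD _ _))//.
by rewrite lerD ?(ltW vw)// distrC E ltW.
Qed.

(** The mean value argument is for real-valued functions, so a vector-valued [f] is composed with a
    continuous linear functional. *)
Lemma mixed_derivatives_linear V W (l : {linear W -> R}) (O : set V) (f : V -> W)
    (p v w : V) :
  continuous l -> open O -> C_on 2 O f -> O p ->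
  l ('D_w (fun q => 'D_v f q) p) = l ('D_v (fun q => 'D_w f q) p).
Proof.
move=> cl oO [df dDf] Op.
apply: (@mixed_derivatives_eq _ (l \o f) (fun q => l ('D_v f q))
  (fun q => l ('D_w f q)) (fun q => l ('D_w (fun z => 'D_v f z) q))
  (fun q => l ('D_v (fun z => 'D_w f z) q)) p v w).
- near=> q; have Oq : O q by near: q; exact: open_nbhs_nbhs.
  by split; apply: is_derive_linear => //; apply/derivableP/diff_derivable;
    [exact: df|exact: df|apply: (dDf v).1|apply: (dDf w).1].
- by apply: continuous_comp; [exact: (dDf v).2|exact: cl].
- by apply: continuous_comp; [exact: (dDf w).2|exact: cl].
Unshelve. all: by end_near. Qed.

(** * One-sided limits and constancy on a closed interval *)

Lemma cvg_right_within W (f : R -> W) (a b t : R) :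
  {within `[a, b], continuous f} -> a <= t < b -> f @ t^'+ --> f t.
Proof.
move=> cf /andP[]; rewrite le_eqVlt => /predU1P[<- ab|at_ tb].
  by have [] := (continuous_within_itvP _ ab).1 cf.
have ab := lt_trans at_ tb; have [cfo _ _] := (continuous_within_itvP _ ab).1 cf.
by have /left_right_continuousP[] : f @ t --> f t by apply: cfo; rewrite in_itv/= at_.
Qed.

Lemma cvg_left_within W (f : R -> W) (a b t : R) :
  {within `[a, b], continuous f} -> a < t <= b -> f @ t^'- --> f t.
Proof.
move=> cf /andP[at_]; rewrite le_eqVlt => /predU1P[tb|tb].
  by move: at_; rewrite tb => ab; have [] := (continuous_within_itvP _ ab).1 cf.
have ab := lt_trans at_ tb; have [cfo _ _] := (continuous_within_itvP _ ab).1 cf.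
by have /left_right_continuousP[] : f @ t --> f t by apply: cfo; rewrite in_itv/= at_.
Qed.

Lemma within_continuous_left_right W (f : R -> W) (a b : R) : a < b ->
  (forall t, a <= t < b -> f @ t^'+ --> f t) ->
  (forall t, a < t <= b -> f @ t^'- --> f t) -> {within `[a, b], continuous f}.
Proof.
move=> ab fr fl; apply/(continuous_within_itvP _ ab); split => [t||].
- rewrite in_itv/= => /andP[at_ tb]; apply/left_right_continuousP.
  by split; [apply: fl; rewrite at_ ltW|apply: fr; rewrite tb ltW].
- by apply: fr; rewrite lexx.
- by apply: fl; rewrite lexx ab.
Qed.

(** Induction on the exceptional points: the interval is cut at [d] when [d] lies inside, and
    continuity at [d] joins the two pieces. Without exceptions this is the mean value theorem. *)
Lemma eq_ends_of_derive0 (D : seq R) (f : R -> R) (a b : R) : a <= b ->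
  {within `[a, b], continuous f} ->
  (forall t, a < t < b -> t \notin D -> is_derive t 1 f 0) -> f b = f a.
Proof.
elim: D a b => [|d D IH] a b ab cf df.
  have [t _ /eqP] : exists2 t, t \in `[a, b] & f b - f a = 0 * (b - a).
    by apply: (@MVT_segment _ _ (fun=> 0)) cf => // t; rewrite in_itv/= => /df; exact.
  by rewrite mul0r subr_eq0 => /eqP.
case: (boolP (a < d < b)) => [/andP[ad db]|dab]; last first.
  apply: IH => // t tab tD; apply: df => //; rewrite inE negb_or tD andbT.
  by apply: contraNneq dab => <-.
have -> : f b = f d.
  apply: IH => [||t /andP[dt tb] tD]; first exact: ltW.
    by apply: continuous_subspaceW cf; apply: subset_itvr; rewrite bnd_simp ltW.
  by apply: df; rewrite ?(lt_trans ad) ?inE ?negb_or ?gt_eqF.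
apply: IH => [||t /andP[at_ td] tD]; first exact: ltW.
  by apply: continuous_subspaceW cf; apply: subset_itvl; rewrite bnd_simp ltW.
by apply: df; rewrite ?at_ ?(lt_trans td) ?inE ?negb_or ?lt_eqF.
Qed.

End Calculus.

(** * The scalar product *)

Section Dotv.
Context {R : realType}.
Implicit Types V W : normedModType R.

Fact dotv_is_linear n (v : 'rV[R]_n) : linear (dotv v).
Proof.
move=> k w w'; rewrite /dotv scaler_sumr -big_split; apply: eq_bigr => i _ /=.
by rewrite !mxE mulrDr mulrCA.
Qed.

HB.instance Definition _ n v := GRing.isLinear.Build _ _ _ _
  (@dotv R n v) (dotv_is_linear v).

Lemma dotvC n (v w : 'rV[R]_n) : dotv v w = dotv w v.
Proof. by apply: eq_bigr => i _; rewrite mulrC. Qed.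

Lemma dotvNl n (v w : 'rV[R]_n) : dotv (- v) w = - dotv v w.
Proof. by rewrite dotvC (linearN (dotv w)) /= dotvC. Qed.

Lemma cvg_dotv T (F : set_system T) {FF : Filter F} n (f g : T -> 'rV[R]_n) v w :
  f @ F --> v -> g @ F --> w -> dotv (f t) (g t) @[t --> F] --> dotv v w.
Proof.
move=> fv gw; rewrite /dotv.
apply: cvg_big => [|i _]; [exact: add_continuous|apply: cvgM].
- exact: (cvg_comp f (fun M => M 0 i) fv (@coord_continuous R 1 n 0 i v)).
- exact: (cvg_comp g (fun M => M 0 i) gw (@coord_continuous R 1 n 0 i w)).
Qed.

Lemma dotv_continuous n (v : 'rV[R]_n) : continuous (dotv v).
Proof. by move=> w; apply: (@cvg_dotv _ (nbhs w) _ n (fun=> v) id) => //; exact: cvg_cst. Qed.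

Lemma is_derive_dotv V n (f g : V -> 'rV[R]_n) x v df dg :
  is_derive x v f df -> is_derive x v g dg ->
  is_derive x v (fun y => dotv (f y) (g y)) (dotv df (g x) + dotv (f x) dg).
Proof.
move=> dfx dgx.
have := is_derive_sum (fun i => is_deriveM (is_derive_coord 0 i dfx) (is_derive_coord 0 i dgx)).
rewrite (_ : \sum_i _ = (fun y => dotv (f y) (g y))); last first.
  by apply/funext => y; rewrite fct_sumE.
move/is_derive_eq; apply; rewrite -big_split; apply: eq_bigr => i _ /=.
by rewrite addrC; congr (_ + _); exact: mulrC.
Qed.

Lemma dotv_grad n (f : 'rV[R]_n -> R) p w :
  differentiable f p -> dotv (grad f p) w = 'd f p w.
Proof.
move=> fp; rewrite [in RHS](row_sum_delta w) linear_sum; apply: eq_bigr => j _.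
by rewrite mxE deriveE// linearZ mulrC.
Qed.

End Dotv.

Lemma near_neq (R : realType) (t d : R) : t != d -> \forall z \near t, z != d.
Proof.
rewrite -subr_eq0 => td.
have cd : z - d @[z --> t] --> t - d by apply: cvgB => //; exact: cvg_cst.
by apply: filterS (cvgr_neq0 _ cd td) => z; rewrite subr_eq0.
Qed.

(** The point [t] itself may belong to [D]. Hence a continuity point of the control, listed in [D]
    or not, has only continuity points nearby. *)
Lemma near_notin (R : realType) (D : seq R) (t : R) :
  \forall z \near t, z != t -> z \notin D.
Proof.
elim: D => [|d D IH]; first by near=> z; rewrite in_nil.
have [->|dt] := eqVneq d t.
  near=> z => zt; rewrite inE negb_or zt /=.
  by apply: (near IH z).
near=> z => zt; rewrite inE negb_or (near IH z)// andbT.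
by near: z; apply: near_neq; rewrite eq_sym.
Unshelve. all: by end_near. Qed.

(** * Changing the control at a single time *)

Section Invariance.
Context (R : realType) (n r N : nat) (P : control_problem R n r N).
Context (eps : R) (h : R -> txu R n r -> txu R n r).

Local Notation a := (t_init P).
Local Notation b := (t_final P).

Definition update_at (t : R) (v : 'rV[R]_r) (u : R -> 'rV[R]_r) (z : R) :=
  if z == t then v else u z.

Lemma near_update_at t v u z : z != t -> \forall y \near z, u y = update_at t v u y.
Proof.
by move=> zt; near=> y; rewrite /update_at ifN//; near: y; exact: near_neq.
Unshelve. all: by end_near. Qed.

Lemma dnbhs_update_at t v u z : \forall y \near z^', u y = update_at t v u y.
Proof.
have [->|zt] := eqVneq z t; last exact/nbhs_dnbhs/near_update_at.
by near=> y; rewrite /update_at ifN//; near: y; exact: nbhs_dnbhs_neq.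
Unshelve. all: by end_near. Qed.

Lemma at_right_update_at t v u z : \forall y \near z^'+, u y = update_at t v u y.
Proof.
have := dnbhs_update_at t v u z; rewrite !near_withinE => uy.
by near=> y => zy; apply: (near uy y); rewrite // gt_eqF.
Unshelve. all: by end_near. Qed.

Lemma at_left_update_at t v u z : \forall y \near z^'-, u y = update_at t v u y.
Proof.
have := dnbhs_update_at t v u z; rewrite !near_withinE => uy.
by near=> y => zy; apply: (near uy y); rewrite // lt_eqF.
Unshelve. all: by end_near. Qed.

Lemma continuous_update_at t v u z : z != t ->
  {for z, continuous u} <-> {for z, continuous (update_at t v u)}.
Proof.
move=> zt; have uz := near_update_at v u zt.
have -> : {for z, continuous (update_at t v u)} = (update_at t v u @ z --> u z).
  by rewrite /prop_for /continuous_at {2}/update_at (negbTE zt).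
split; apply: cvg_trans; apply: near_eq_cvg => //.
by near=> y; rewrite (near uz y).
Unshelve. all: by end_near. Qed.

(** One-sided limits do not see the value at [t], and [t] joins the list of discontinuities. If [v]
    differs from [u t], the new control jumps at [t], where the state equation then imposes
    nothing. *)
Lemma process_update_at x u t v : process P x u -> ctrl_set P v ->
  {for t, continuous u} -> process P x (update_at t v u).
Proof.
move=> pxu Ov ut; have [vu|vu] := eqVneq v (u t).
  by rewrite (_ : update_at t v u = u)//; apply/funext => z; rewrite /update_at vu;
    case: eqP => [->|].
case: pxu => -[[D uD] ur ul] Ou [cx dx]; split.
- split.
  + exists (t :: D) => z zab; rewrite inE negb_or => /andP[zt zD].
    exact: (continuous_update_at v u zt).1 (uD z zab zD).
  + move=> z /ur /cvg_ex[l ul']; apply/cvg_ex; exists l.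
    by apply: cvg_trans ul'; exact/near_eq_cvg/at_right_update_at.
  + move=> z /ul /cvg_ex[l ul']; apply/cvg_ex; exists l.
    by apply: cvg_trans ul'; exact/near_eq_cvg/at_left_update_at.
- by move=> z /Ou; rewrite /update_at; case: ifP.
- split=> // z zab; have [->|zt] := eqVneq z t; last first.
    by move=> /(continuous_update_at v u zt).2 /(dx _ zab); rewrite /update_at (negbTE zt).
  (* Were the new control continuous at [t], it would tend there both to [v] and to [u t]. *)
  move=> /continuous_withinNx cv; exfalso; move/eqP : vu; apply.
  have -> : v = update_at t v u t by rewrite /update_at eqxx.
  apply: (cvg_unique _ cv) => //.
  apply: cvg_trans (near_eq_cvg (dnbhs_update_at t v u t)) _.
  exact/continuous_withinNx.
Qed.

Hypothesis h_invariant : invariant_under P eps h.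

Let within_eq (W : normedModType R) (f f' : R -> W) t : a < t < b ->
  {within `[a, b], continuous f} -> {within `[a, b], continuous f'} ->
  (forall z, z != t -> f z = f' z) -> f t = f' t.
Proof.
move=> /andP[at_ tb] cf cf' ff'.
have tab : a <= t < b by rewrite ltW.
apply: (cvg_unique _ (cvg_right_within cf tab)) => //.
apply: cvg_trans (cvg_right_within cf' tab).
apply: near_eq_cvg; near=> z; by rewrite ff'// gt_eqF.
Unshelve. all: by end_near. Qed.

(* Changing [u] at the single time [t] affects neither the state equation nor
   the continuity of [h s] along the process. *)
Lemma invariant_control_irrelevant x u s t v : process P x u -> `|s| < eps ->
  a < t < b -> {for t, continuous u} -> ctrl_set P v ->
  (h s (t, x t, v)).1 = (h s (t, x t, u t)).1.
Proof.
move=> pxu seps tab ut Ov; have pxu' := process_update_at pxu Ov ut.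
have [[cT _] [cX _] _] := h_invariant pxu seps.
have [[cT' _] [cX' _] _] := h_invariant pxu' seps.
have vt : v = update_at t v u t by rewrite /update_at eqxx.
rewrite [LHS]surjective_pairing [RHS]surjective_pairing [in LHS]vt.
congr (_, _).
- by apply: (within_eq tab cT' cT) => z zt; rewrite /update_at (negbTE zt).
- by apply: (within_eq tab cX' cX) => z zt; rewrite /update_at (negbTE zt).
Qed.

End Invariance.

(** Each real coordinate of the time and state components is a continuous linear functional, so
    symmetry holds coordinatewise. *)
Lemma mixed_derivatives_fst (R : realType) (V W : normedModType R) n (O : set V)
    (f : V -> (R * 'rV[R]_n * W)%type) (p v w : V) :
  open O -> C_on 2 O f -> O p ->
  ('D_w (fun q => 'D_v f q) p).1 = ('D_v (fun q => 'D_w f q) p).1.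
Proof.
move=> oO fC2 Op.
have cfst : continuous (fst : R * 'rV[R]_n * W -> (R * 'rV[R]_n)%type).
  by move=> q; exact: cvg_fst.
apply: injective_projections.
  pose l : {linear (R * 'rV[R]_n * W)%type -> R} :=
    (fst : {linear (R * 'rV[R]_n)%type -> R}) \o
    (fst : {linear (R * 'rV[R]_n * W)%type -> (R * 'rV[R]_n)%type}).
  apply: (@mixed_derivatives_linear R V _ l O f p v w _ oO fC2 Op) => q.
  by apply: continuous_comp; [exact: cfst|exact: cvg_fst].
apply/rowP => i.
pose l : {linear (R * 'rV[R]_n * W)%type -> R} := (mx_coord 0 i) \o
  ((snd : {linear (R * 'rV[R]_n)%type -> 'rV[R]_n}) \o
   (fst : {linear (R * 'rV[R]_n * W)%type -> (R * 'rV[R]_n)%type})).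
apply: (@mixed_derivatives_linear R V _ l O f p v w _ oO fC2 Op) => q.
apply: continuous_comp; last exact: coord_continuous.
by apply: continuous_comp; [exact: cfst|exact: cvg_snd].
Qed.

(** * The infinitesimal generator of the transformation group *)

Section Generator.
Context (R : realType) (n r N : nat) (P : control_problem R n r N).
Context (eps : R) (h : R -> txu R n r -> txu R n r).
Context (O : set (txu R n r * R)) (g : txu R n r * R -> txu R n r).

Local Notation a := (t_init P).
Local Notation b := (t_final P).

Hypothesis eps_gt0 : 0 < eps.
Hypothesis oO : open O.
Hypothesis dom_O :
  [set q : txu R n r * R | a <= q.1.1.1 <= b /\ `|q.2| < eps] `<=` O.
Hypothesis gC2 : C_on 2 O g.
Hypothesis hg : forall q : txu R n r * R,
  a <= q.1.1.1 <= b /\ `|q.2| < eps -> h q.2 q.1 = g q.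

Implicit Types (p : txu R n r) (s : R).

(** Taken from the extension [g], smooth on an open set, so that it can be differentiated again in
    every direction. For times in [[a, b]] it is the derivative of [h] in [s] at [0]. *)
Definition generator (p : txu R n r) : txu R n r := 'D_(0, 1) g (p, 0).

Let near_eps (s : R) : `|s| < eps -> \forall z \near s, `|z| < eps.
Proof.
move=> seps; near=> z; near: z.
by apply: (cvgr_lt `|s|) => //; exact: norm_continuous.
Unshelve. all: by end_near. Qed.

Let diff_g p s : a <= p.1.1 <= b -> `|s| < eps -> differentiable g (p, s).
Proof. by move=> pab seps; apply: gC2.1; apply: dom_O. Qed.

Let diff_Dg v p s : a <= p.1.1 <= b -> `|s| < eps ->
  differentiable (fun q => 'D_v g q) (p, s).
Proof. by move=> pab seps; apply: (gC2.2 v).1; apply: dom_O. Qed.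

Let is_derive_s (W : normedModType R) (f : txu R n r * R -> W) (p : txu R n r) (s : R) :
  differentiable f (p, s) ->
  is_derive s 1 (fun z => f (p, z)) ('D_(0, 1) f (p, s)).
Proof.
move=> df; have line z : (p, z) = (p, 0) + z *: (0, 1) :> (txu R n r * R)%type.
  congr (_, _); last by rewrite /= add0r; exact/esym/mulr1.
  by rewrite /= scaler0 addr0.
have -> : (fun z => f (p, z)) = (fun z => f ((p, 0) + z *: (0, 1))).
  by apply/funext => z; rewrite line.
by apply: is_derive_along; rewrite -line; exact/derivableP/diff_derivable.
Qed.

Lemma is_derive_flow p s : a <= p.1.1 <= b -> `|s| < eps ->
  is_derive s 1 (fun z => h z p) ('D_(0, 1) g (p, s)).
Proof.
move=> pab seps; apply: (near_eq_is_derive _ (is_derive_s (diff_g pab seps))).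
by apply: filterS (near_eps seps) => z zeps; rewrite -hg.
Qed.

Lemma is_derive_flow0 p : a <= p.1.1 <= b ->
  is_derive (0 : R) 1 (fun z => h z p) (generator p).
Proof. by move=> pab; apply: is_derive_flow; rewrite ?normr0. Qed.

Lemma generator1E p : a <= p.1.1 <= b ->
  (generator p).1 = 'D_1 (fun s => (h s p).1) (0 : R).
Proof. by move=> pab; have [_ E] := is_derive_fst (is_derive_flow0 pab); exact: esym. Qed.

(** Carries the independence of the control value from [h] over to the time and state components of
    the generator. *)
Lemma generator_eq1 p (q : txu R n r) : a <= p.1.1 <= b -> a <= q.1.1 <= b ->
  (forall s, `|s| < eps -> (h s p).1 = (h s q).1) ->
  (generator p).1 = (generator q).1.
Proof.
move=> pab qab hpq.
apply: etrans (generator1E pab) (etrans _ (esym (generator1E qab))).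
apply: near_eq_derive.
have eps0 : `|0 : R| < eps by rewrite normr0.
by apply: filterS (near_eps eps0) => s; exact: hpq.
Qed.

(* At a jump of [u] the generator itself is discontinuous in the point, but
   [h s] is continuous along the process for each [s], so that its values at
   the one-sided limit and at the point agree. *)
Lemma generator_cvg (F : set_system R) {FF : ProperFilter F}
    (x : R -> 'rV[R]_n) (u : R -> 'rV[R]_r) t0 :
  t @[t --> F] --> t0 -> x @ F --> x t0 -> cvg (u @ F) -> a <= t0 <= b ->
  (\forall t \near F, a <= t <= b) ->
  (forall s, `|s| < eps ->
    (h s (t, x t, u t)).1 @[t --> F] --> (h s (t0, x t0, u t0)).1) ->
  (generator (t, x t, u t)).1 @[t --> F] --> (generator (t0, x t0, u t0)).1.
Proof.
move=> Ft Fx /cvg_ex[ul Fu] t0ab Fab Fh.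
have cfst : continuous (fst : txu R n r -> (R * 'rV[R]_n)%type).
  by move=> q; exact: cvg_fst.
have Fp : (t, x t, u t) @[t --> F] --> (t0, x t0, ul).
  exact: cvg_pair (cvg_pair Ft Fx) Fu.
have Fq s : ((t, x t, u t), s) @[t --> F] --> ((t0, x t0, ul), s).
  exact: cvg_pair Fp (cvg_cst s).
(* For each [s] the flow has two limits along [F]: the value at [ul], by continuity of [g], and the
   value at [u t0], by assumption. They coincide. *)
have gen_ul : (generator (t0, x t0, ul)).1 = (generator (t0, x t0, u t0)).1.
  apply: generator_eq1 => // s seps.
  have Fg : g ((t, x t, u t), s) @[t --> F] --> g ((t0, x t0, ul), s).
    exact: (cvg_comp _ g (Fq s) (differentiable_continuous (@diff_g (t0, x t0, ul) s t0ab seps))).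
  have Fhl : h s (t, x t, u t) @[t --> F] --> h s (t0, x t0, ul).
    rewrite (_ : h s _ = g ((t0, x t0, ul), s)); last by rewrite -hg.
    apply: cvg_trans Fg; apply: near_eq_cvg.
    by apply: filterS Fab => t tab; rewrite -hg.
  have Fhl1 : (h s (t, x t, u t)).1 @[t --> F] --> (h s (t0, x t0, ul)).1.
    exact: cvg_comp Fhl (cfst _).
  exact: (@cvg_unique (R * 'rV[R]_n)%type (@norm_hausdorff _ _) _ _ _ _ Fhl1 (Fh s seps)).
have cvg_eq (f : R -> (R * 'rV[R]_n)%type) (l l' : (R * 'rV[R]_n)%type) :
  l = l' -> f @ F --> l -> f @ F --> l' by move=> ->.
have eps0 : `|0 : R| < eps by rewrite normr0.
have Fgen : generator (t, x t, u t) @[t --> F] --> generator (t0, x t0, ul).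
  exact: (cvg_comp _ _ (Fq 0)
    (differentiable_continuous (@diff_Dg (0, 1) (t0, x t0, ul) 0 t0ab eps0))).
have Fgen1 : (generator (t, x t, u t)).1 @[t --> F] --> (generator (t0, x t0, ul)).1.
  exact: cvg_comp Fgen (cfst _).
exact: cvg_eq gen_ul Fgen1.
Qed.

(* By [invariant_control_irrelevant] the control can be frozen at [u t0], which
   makes [h s] a smooth function of [t] although [u] is only continuous. *)
Lemma is_derive_generator (x : R -> 'rV[R]_n) (u : R -> 'rV[R]_r) t0 :
  invariant_under P eps h -> process P x u -> a < t0 < b ->
  {for t0, continuous u} ->
  exists2 dh : R -> (R * 'rV[R]_n)%type,
    forall s, `|s| < eps -> is_derive t0 1 (fun t => (h s (t, x t, u t)).1) (dh s)
    & exists2 dgen, is_derive (0 : R) 1 dh dgen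
        & is_derive t0 1 (fun t => (generator (t, x t, u t)).1) dgen.
Proof.
move=> h_inv pxu t0ab ut0; have [[[D uD] _ _] Ou [_ dx]] := pxu.
have t0ab' : a <= t0 <= b by case/andP: t0ab => /ltW-> /ltW->.
set v := u t0; have Ov : ctrl_set P v by exact: Ou.
set x' := dyn P (t0, x t0, u t0).
pose w : txu R n r * R := (1, x', 0, 0); pose q0 := (t0, x t0, v).
have near_t0 : \forall t \near t0, a < t < b /\ {for t, continuous u}.
  near=> t; have tab : a < t < b.
    apply/andP; split; near: t; [apply: lt_nbhsr|apply: lt_nbhsl];
      by case/andP: t0ab.
  split; first exact: tab.
  have [->|tt0] := eqVneq t t0; first exact: ut0.
  by apply: (uD _ tab); apply: (near (near_notin D t0) t).
have h_frozen s t : `|s| < eps -> a < t < b -> {for t, continuous u} ->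
    (h s (t, x t, u t)).1 = (h s (t, x t, v)).1.
  by move=> seps tab ut; rewrite -(invariant_control_irrelevant h_inv pxu seps tab ut Ov).
have along (W : normedModType R) (f : txu R n r * R -> W) s : differentiable f (q0, s) ->
    is_derive t0 1 (fun t => f ((t, x t, v), s)) ('D_w f (q0, s)).
  move=> df; rewrite deriveE//; apply: (is_derive_curve _ df).
  apply: is_derive_pair; apply: is_derive_pair; apply: is_derive_pair.
  exact: dx.
exists (fun s => ('D_w g (q0, s)).1).
  move=> s seps.
  apply: near_eq_is_derive (is_derive_fst (along _ g s (@diff_g q0 s t0ab' seps))).
  near=> t.
  have [|tab ut] := near near_t0 t; first by []. rewrite ?h_frozen//.
  by rewrite -hg//; case/andP: tab => /ltW-> /ltW->.
exists ('D_(0, 1) (fun q => 'D_w g q) (q0, 0)).1.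
  by apply/is_derive_fst/is_derive_s; apply: diff_Dg; rewrite ?normr0.
have Oq0 : O (q0, 0) by apply: dom_O; rewrite /= normr0.
have D0 : differentiable (fun q => 'D_(0, 1) g q) (q0, 0 : R).
  by apply: diff_Dg; rewrite ?normr0.
have Dgen : is_derive t0 1 (fun t => (generator (t, x t, u t)).1)
    ('D_w (fun q => 'D_(0, 1) g q) (q0, 0)).1.
  apply: near_eq_is_derive (is_derive_fst (along _ _ 0 D0)); near=> t.
  have [|tab ut] := near near_t0 t; first by [].
  have tab' : a <= t <= b by case/andP: tab => /ltW-> /ltW->.
  by apply/esym/generator_eq1 => // s seps; exact: h_frozen.
(* The derivative of [dh] is taken along [w] and then in [s], that of the generator in the opposite
   order. *)
have mixed := mixed_derivatives_fst w (0, 1) oO gC2 Oq0.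
exact: (is_derive_eq Dgen (esym mixed)).
Unshelve. all: by end_near. Qed.

End Generator.

(** * The Noether identity along an extremal *)

Section Noether.
Context (R : realType) (n r N : nat) (P : control_problem R n r N).
Context (eps : R) (h : R -> txu R n r -> txu R n r).
Context (O : set (txu R n r * R)) (g : txu R n r * R -> txu R n r).

Local Notation a := (t_init P).
Local Notation b := (t_final P).

Hypothesis lagr_C1 : C_on 1 setT (lagr P).
Hypothesis dyn_C1 : C_on 1 setT (dyn P).
Hypothesis eps_gt0 : 0 < eps.
Hypothesis oO : open O.
Hypothesis dom_O :
  [set q : txu R n r * R | a <= q.1.1.1 <= b /\ `|q.2| < eps] `<=` O.
Hypothesis gC2 : C_on 2 O g.
Hypothesis hg : forall q : txu R n r * R,
  a <= q.1.1.1 <= b /\ `|q.2| < eps -> h q.2 q.1 = g q.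
Hypothesis h0 : forall p : txu R n r, a <= p.1.1 <= b -> h 0 p = p.
Hypothesis h_invariant : invariant_under P eps h.
Hypothesis h_controls : respects_controls P h.

Implicit Types (p : txu R n r) (s t : R).

(** With the multipliers fixed, a single differential at [(t, x, u)] contains the partial
    derivatives in time, state and control. *)
Definition point_hamiltonian (psi : 'rV[R]_n) (lam : 'rV[R]_N) p : R :=
  dotv lam (lagr P p) + dotv psi (dyn P p).

Lemma differentiable_point_hamiltonian psi lam p :
  differentiable (point_hamiltonian psi lam) p.
Proof.
apply: (@differentiableD _ _ _ (dotv lam \o lagr P) (dotv psi \o dyn P)).
- apply: differentiable_comp; first exact: lagr_C1.1.
  exact/linear_differentiable/dotv_continuous.
- apply: differentiable_comp; first exact: dyn_C1.1.
  exact/linear_differentiable/dotv_continuous.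
Qed.

Let eps0 : `|0 : R| < eps. Proof. by rewrite normr0. Qed.

Lemma noether_quantityE t x u psi lam : a <= t <= b ->
  noether_quantity P h t x u psi lam =
  dotv psi (generator g (t, x, u)).1.2
  - hamiltonian P t x u psi lam * (generator g (t, x, u)).1.1.
Proof.
move=> tab; have flow := is_derive_fst (is_derive_flow0 eps_gt0 dom_O gC2 hg (p := (t, x, u)) tab).
have [_ E1] := is_derive_fst flow; have [_ E2] := is_derive_snd flow.
rewrite /noether_quantity; congr (dotv _ _ - _ * _).
- by apply: etrans E2; rewrite derive1E.
- by apply: etrans E1; rewrite derive1E.
Qed.

(** Both sides are the derivative at [s = 0] of one function [K]. The two invariance identities,
    paired with the constant vectors [psi] and [lam] and added, give two expressions for it. *)
Lemma invariance_infinitesimal x u t0 psi lam dgen :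
  process P x u -> a < t0 < b -> {for t0, continuous u} ->
  is_derive t0 1 (fun t => (generator g (t, x t, u t)).1) dgen ->
  let q0 := (t0, x t0, u t0) in
  dotv psi dgen.2 = dgen.1 * point_hamiltonian psi lam q0
    + 'd (point_hamiltonian psi lam) q0 (generator g q0).
Proof.
move=> pxu t0ab ut0 Dgen q0.
have t0ab' : a <= t0 <= b by case/andP: t0ab => /ltW-> /ltW->.
have [dh Dh [dgen' Ddh Dgen']] :=
  is_derive_generator eps_gt0 oO dom_O gC2 hg h_invariant pxu t0ab ut0.
have {Dgen Dgen'} dgenE : dgen' = dgen.
  by case: Dgen => _ <-; case: Dgen' => _ <-.
rewrite {}dgenE in Ddh.
(* At [s = 0] the transformation is the identity, so time has speed one. *)
have dh01 : (dh 0).1 = 1.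
  have [_ <-] := is_derive_fst (Dh 0 eps0).
  have [_ E] : is_derive t0 1 (fun t => (h 0 (t, x t, u t)).1.1) 1.
    apply: near_eq_is_derive (is_derive_id t0 (1 : R)); near=> t.
    rewrite h0//=; apply/andP; split; apply/ltW.
    - by near: t; apply: lt_nbhsr; case/andP: t0ab.
    - by near: t; apply: lt_nbhsl; case/andP: t0ab.
  exact: E.
have dhE s : `|s| < eps -> dotv lam (lagr P q0) + dotv psi (dh s).2
    = (dh s).1 * point_hamiltonian psi lam (h s q0).
  move=> seps; have [[_ dT] [_ dX] LE] := h_invariant pxu seps.
  have [_ ET] := is_derive_fst (Dh s seps).
  have [_ EX] := is_derive_snd (Dh s seps).
  have [_ EX'] := dX t0 t0ab ut0.
  have T'E : derive1 (fun t => (h s (t, x t, u t)).1.1) t0 = (dh s).1.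
    by rewrite derive1E.
  have -> : (dh s).2 = (dh s).1 *: dyn P (h s q0) by rewrite -EX EX' T'E.
  by rewrite (LE t0 t0ab ut0) T'E !linearZ /= mulrDr.
(* As a product, [K] yields the right-hand side. By [dhE] it is also a constant plus
   [dotv psi (dh s).2], which yields the left-hand side. *)
pose K s := (dh s).1 * point_hamiltonian psi lam (h s q0).
have flow := is_derive_flow0 eps_gt0 dom_O gC2 hg (p := q0) t0ab'.
have h0q0 : h 0 q0 = q0 by exact: h0.
have [_ DK] : is_derive (0 : R) 1 K (dgen.1 * point_hamiltonian psi lam q0
    + 'd (point_hamiltonian psi lam) q0 (generator g q0)).
  have dH := differentiable_point_hamiltonian psi lam (h 0 q0).
  have := is_deriveM (is_derive_fst Ddh) (is_derive_curve flow dH).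
  rewrite dh01 h0q0 => /is_derive_eq; apply.
  by rewrite scale1r addrC /= h0q0; congr (_ + _); exact: mulrC.
have [_ DK'] : is_derive (0 : R) 1 K (dotv psi dgen.2).
  have := is_deriveD (is_derive_cst (dotv lam (lagr P q0)) (0 : R) 1)
    (is_derive_linear (l := dotv psi) (@dotv_continuous _ _ psi) (is_derive_snd Ddh)).
  rewrite add0r; apply: near_eq_is_derive; near=> s.
  apply: dhE; near: s.
  by apply: (cvgr_lt `|0 : R|) => //; exact: norm_continuous.
exact: etrans (esym DK') DK.
Unshelve. all: by end_near. Qed.

(** With time and state frozen, the transformed control stays in the control set for small [s], so
    the Hamiltonian along it is maximal at [s = 0]. As the control set is arbitrary, stationarity is
    claimed in this direction only. *)
Lemma control_stationarity x u psi lam t0 : Pareto_extremal P x u psi lam ->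
  a < t0 < b ->
  let q0 := (t0, x t0, u t0) in
  'd (point_hamiltonian (psi t0) lam) q0 (0, 0, (generator g q0).2) = 0.
Proof.
move=> ext t0ab q0; have [pxu _ _] := extremal_admissible ext.
have t0ab' : a <= t0 <= b by case/andP: t0ab => /ltW-> /ltW->.
set Hq := point_hamiltonian (psi t0) lam.
pose c s : txu R n r := (t0, x t0, (h s q0).2).
have c0 : c 0 = q0 by rewrite /c h0.
have Dc s : `|s| < eps -> is_derive s 1 c (0, 0, ('D_(0, 1) g (q0, s)).2).
  move=> seps; apply: is_derive_pair.
  exact: is_derive_snd (is_derive_flow dom_O gC2 hg (p := q0) t0ab' seps).
have DHc s : `|s| < eps -> derivable (Hq \o c) s 1.
  move=> /Dc cs.
  by have [] := is_derive_curve cs (differentiable_point_hamiltonian (psi t0) lam (c s)).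
have /nbhs_ballP[d /= d0 d_max] : \forall s \near 0, ctrl_set P (h s q0).2 /\ `|s| < eps.
  near=> s; split; near: s; first exact: h_controls.
  by apply: (cvgr_lt `|0 : R|) => //; exact: norm_continuous.
have in_ball s : s \in `]- d, d[ -> ctrl_set P (h s q0).2 /\ `|s| < eps.
  by rewrite in_itv/= -ltr_norml => sd; apply: d_max; rewrite -ball_normE/= sub0r normrN.
have [_ max0] : is_derive (0 : R) 1 (Hq \o c) 0.
  apply: (@derive1_at_max _ _ (- d) d) => [||| s /in_ball[Os _]].
  - by rewrite ge0_cp ?ltW.
  - by move=> s /in_ball[_ /DHc].
  - by rewrite in_itv/= oppr_lt0 d0.
  rewrite /= c0; exact: (extremal_maximality ext t0ab' Os).
have [_ E] := is_derive_curve (Dc 0 eps0) (differentiable_point_hamiltonian (psi t0) lam (c 0)).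
by move: E; rewrite max0 c0.
Unshelve. all: by end_near. Qed.

(** Writes the right-hand side of the adjoint equation through the full differential, where it can
    be combined with the generator by linearity. *)
Lemma dotv_grad_hamiltonian t y (v : 'rV[R]_r) psi lam w :
  dotv (grad (fun z => hamiltonian P t z v psi lam) y) w =
  'd (point_hamiltonian psi lam) (t, y, v) (0, w, 0).
Proof.
pose c (z : 'rV[R]_n) : txu R n r := (t, z, v).
have dc : is_diff y c (fun z => (0, z, 0)).
  by apply: is_diff_pair; apply: is_diff_pair.
have cy : differentiable c y by case: dc.
have dH := differentiable_point_hamiltonian psi lam (c y).
have -> : (fun z => hamiltonian P t z v psi lam) = point_hamiltonian psi lam \o c by [].
rewrite dotv_grad; last exact: differentiable_comp.
by rewrite diff_comp//=; case: dc => _ ->.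
Qed.

Lemma derive1_hamiltonian t y (v : 'rV[R]_r) psi lam :
  derive1 (fun z => hamiltonian P z y v psi lam) t =
  'd (point_hamiltonian psi lam) (t, y, v) (1, 0, 0).
Proof.
pose c (z : R) : txu R n r := (z, y, v).
have dc : is_derive t 1 c (1, 0, 0) by apply: is_derive_pair; apply: is_derive_pair.
have [_ <-] := is_derive_curve dc (differentiable_point_hamiltonian psi lam (c t)).
by rewrite derive1E.
Qed.

Lemma is_derive_noether_quantity x u psi lam t0 : Pareto_extremal P x u psi lam ->
  a < t0 < b -> {for t0, continuous u} ->
  is_derive t0 1 (fun t => noether_quantity P h t (x t) (u t) (psi t) lam) 0.
Proof.
move=> ext t0ab ut0; have [pxu _ _] := extremal_admissible ext.
have [_ _ [dgen _ Dgen]] :=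
  is_derive_generator eps_gt0 oO dom_O gC2 hg h_invariant pxu t0ab ut0.
have Dpsi := (extremal_adjoint ext).2 t0 t0ab ut0.
have DH := (extremal_hamiltonian ext).2 t0 t0ab ut0.
have Dtau := is_derive_fst Dgen; have Dxi := is_derive_snd Dgen.
have DF := is_deriveB (is_derive_dotv Dpsi Dxi) (is_deriveM DH Dtau).
suff E0 : dotv (- grad (fun y => hamiltonian P t0 y (u t0) (psi t0) lam) (x t0))
      (generator g (t0, x t0, u t0)).1.2 + dotv (psi t0) dgen.2
    - (hamiltonian P t0 (x t0) (u t0) (psi t0) lam *: dgen.1
       + (generator g (t0, x t0, u t0)).1.1 *:
         derive1 (fun t => hamiltonian P t (x t0) (u t0) (psi t0) lam) t0) = 0.
  apply: near_eq_is_derive (is_derive_eq DF E0); near=> t.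
  apply/esym/noether_quantityE; apply/andP; split; apply/ltW.
  - by near: t; apply: lt_nbhsr; case/andP: t0ab.
  - by near: t; apply: lt_nbhsl; case/andP: t0ab.
(* The derivative of the state component of the generator, paired with [psi], is eliminated. *)
rewrite (invariance_infinitesimal (psi t0) lam pxu t0ab ut0 Dgen).
rewrite dotvNl dotv_grad_hamiltonian derive1_hamiltonian.
have := control_stationarity ext t0ab.
set q0 := (t0, x t0, u t0); set dH := 'd _ q0; set m := generator g q0 => dHu.
(* The control part of [dH m] vanishes by stationarity; the state part cancels the adjoint term, and
   the time part cancels the derivative of the Hamiltonian. *)
have -> : dH m = m.1.1 *: dH (1, 0, 0) + dH (0, m.1.2, 0) + dH (0, 0, m.2).
  rewrite -linearZ -!linearD; congr (dH _).
  rewrite [LHS]surjective_pairing [m.1 in LHS]surjective_pairing.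
  by congr (_, _, _); rewrite /= ?scaler0 ?addr0 ?add0r//; exact/esym/mulr1.
rewrite dHu addr0 mulrC; set H0 := point_hamiltonian _ _ _.
have -> : hamiltonian P t0 (x t0) (u t0) (psi t0) lam = H0 by [].
have cancel (A B C : R) : - A + (C + (B + A)) - (C + B) = 0 by ring.
exact: cancel.
Unshelve. all: by end_near. Qed.

End Noether.

(** * Constancy of the Noether quantity on the whole interval *)

Theorem theorem4p2 (R : realType) (n r N : nat) (P : control_problem R n r N)
    (eps : R) (h : R -> txu R n r -> txu R n r)
    (lt_ab : t_init P < t_final P)
    (lagr_C1 : C_on 1 setT (lagr P))
    (dyn_C1 : C_on 1 setT (dyn P))
    (eps_gt0 : 0 < eps)
    (h_group : C2_one_parameter_group P eps h)
    (h_invariant : invariant_under P eps h)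
    (h_controls : respects_controls P h) :
  unimprovable_conservation_law P (noether_quantity P h).
Proof.
move=> x u psi lam ext.
have [pxu _ _] := extremal_admissible ext.
have [[[D uD] ur ul] _ [cx _]] := pxu.
have [[ O [g [oO dom_O gC2 hg]]] h0 _] := h_group.
set a := t_init P in lt_ab *; set b := t_final P in lt_ab *.
pose F t := noether_quantity P h t (x t) (u t) (psi t) lam.
(* Stated for a filter [G] so as to cover left and right limits at once. The limit of [u] along [G]
   may differ from [u t0]. *)
have cvg_F (G : set_system R) t0 : ProperFilter G -> a <= t0 <= b ->
    t @[t --> G] --> t0 -> (\forall t \near G, a <= t <= b) -> cvg (u @ G) ->
    (forall (W : normedModType R) (f : R -> W),
      {within `[a, b], continuous f} -> f @ G --> f t0) ->
    F @ G --> F t0.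
  move=> PG t0ab Gt0 Gab uG within_cvg.
  have Ggen : (generator g (t, x t, u t)).1 @[t --> G] -->
      (generator g (t0, x t0, u t0)).1.
    apply: (generator_cvg eps_gt0 dom_O gC2 hg) => //; first exact: within_cvg.
    move=> s seps; have [[cT _] [cX _] _] := h_invariant x u s pxu seps.
    rewrite [X in _ --> X]surjective_pairing.
    apply: cvg_trans (cvg_pair (within_cvg _ _ cT) (within_cvg _ _ cX)).
    by apply: near_eq_cvg; near=> t; rewrite -surjective_pairing.
  have E t : a <= t <= b -> F t = dotv (psi t) (generator g (t, x t, u t)).1.2
      - hamiltonian P t (x t) (u t) (psi t) lam * (generator g (t, x t, u t)).1.1.
    by move=> tab; exact: (noether_quantityE eps_gt0 dom_O gC2 hg).
  rewrite E//.
  have FE : dotv (psi t) (generator g (t, x t, u t)).1.2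
      - hamiltonian P t (x t) (u t) (psi t) lam * (generator g (t, x t, u t)).1.1
      @[t --> G] -->
      dotv (psi t0) (generator g (t0, x t0, u t0)).1.2
      - hamiltonian P t0 (x t0) (u t0) (psi t0) lam * (generator g (t0, x t0, u t0)).1.1.
    apply: cvgB; [apply: cvg_dotv|apply: cvgM].
    - exact: within_cvg (extremal_adjoint ext).1.
    - exact: cvg_comp Ggen cvg_snd.
    - exact: within_cvg (extremal_hamiltonian ext).1.
    - exact: cvg_comp Ggen cvg_fst.
  by apply: cvg_trans FE; apply: near_eq_cvg; apply: filterS Gab => t /E.
(* The two sides are treated separately, as [u] has only one-sided limits at a jump. *)
have cF : {within `[a, b], continuous F}.
  apply: within_continuous_left_right => // t tab.
  - have t_ab : a <= t <= b by case/andP: tab => -> /ltW->.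
    have /andP[at_ tb] := tab.
    apply: cvg_F => //; last 2 first.
    + exact: ur.
    + by move=> W f cf; exact: cvg_right_within cf tab.
    + exact: cvg_within.
    + near=> z; apply/andP; split; apply: ltW; last first.
        by near: z; exact: nbhs_right_lt.
      by apply: (le_lt_trans at_); near: z; exact: nbhs_right_gt.
  - have t_ab : a <= t <= b by case/andP: tab => /ltW-> ->.
    have /andP[at_ tb] := tab.
    apply: cvg_F => //; last 2 first.
    + exact: ul.
    + by move=> W f cf; exact: cvg_left_within cf tab.
    + exact: cvg_within.
    + near=> z; apply/andP; split; apply: ltW.
        by near: z; exact: nbhs_left_gt.
      by apply: lt_le_trans tb; near: z; exact: nbhs_left_lt.
(* The constant is the initial value; [D], which contains the interior jumps of [u], is the
   exceptional set on [[a, t]]. *)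
exists (F a) => t /andP[at_ tb].
apply: (@eq_ends_of_derive0 R D F a t at_) => [|z /andP[az zt] zD].
  by apply: continuous_subspaceW cF; apply: subset_itvl; rewrite bnd_simp.
have zab : a < z < b by rewrite az (lt_le_trans zt).
apply: (is_derive_noether_quantity lagr_C1 dyn_C1 eps_gt0 oO dom_O gC2 hg h0
  h_invariant h_controls ext zab).
exact: uD.
Unshelve. all: by end_near. Qed.
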